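(* Let $n,k,\ell$ be positive integers, and let $\Gamma=\mathrm{Cay}(\mathbb{Z}_n,\{x^k,x^{-k},x^\ell,x^{-\ell}\})$ be a connected circulant quartic graph. Then: (i) If $k\equiv1\pmod 2$ and $\ell\equiv0\pmod 2$, then $\Gamma$ contains a $(2,2)$-regular set if and only if $n$ is a multiple of $2$. (ii) If $k\equiv1\pmod 2$ and $\ell\equiv1\pmod 2$, then $\Gamma$ contains a $(2,2)$-regular set if and only if $n$ is a multiple of $4$.
   Context: $\mathbb{Z}_n=\langle x\rangle$ denotes the cyclic group of order $n$, written multiplicatively. For a finite group $G$ with identity $e$ and an inverse-closed subset $S\subseteq G\setminus\{e\}$, the Cayley graph $\mathrm{Cay}(G,S)$ is the simple graph with vertex set $G$ in which $y$ and $z$ are adjacent if and only if $y^{-1}z\in S$. A circulant quartic graph is a graph $\mathrm{Cay}(\mathbb{Z}_n,\{x^k,x^{-k},x^\ell,x^{-\ell}\})$ where $x^k,x^{-k},x^\ell,x^{-\ell}$ are four distinct non-identity elements. For a graph $\Gamma$ and nonnegative integers $a,b$, a nonempty proper subset $C$ of $V(\Gamma)$ is an $(a,b)$-regular set of $\Gamma$ if every vertex in $C$ has exactly $a$ neighbours in $C$ and every vertex in $V(\Gamma)\setminus C$ has exactly $b$ neighbours in $C$. *)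

(* Defs.v *)
From mathcomp Require Import all_boot all_fingroup.

Set Implicit Arguments.
Unset Strict Implicit.
Unset Printing Implicit Defensive.

Import GroupScope.

(* A finite simple graph is a symmetric irreflexive relation on a finType. *)
Definition simple_graph (T : finType) (e : rel T) : Prop :=
  symmetric e /\ irreflexive e.

Definition connected_graph (T : finType) (e : rel T) : Prop :=
  forall y z : T, connect e y z.

Definition nb_in (T : finType) (e : rel T) (C : {set T}) (v : T) : nat :=
  #|[set w in C | e v w]|.

Definition regular_set (T : finType) (e : rel T) (a b : nat) (C : {set T}) :
    Prop :=
  [/\ C != set0,
      C \proper [set: T],
      forall v, v \in C -> nb_in e C v = a
    & forall v, v \notin C -> nb_in e C v = b].

Definition cayley (gT : finGroupType) (S : {set gT}) : rel gT :=
  fun y z => y^-1 * z \in S.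

Lemma cayley_simple (gT : finGroupType) (S : {set gT}) :
  1 \notin S -> (forall s, s \in S -> s^-1 \in S) -> simple_graph (cayley S).
Proof.
move=> S1 SV; split=> [y z|y]; last by rewrite /cayley mulVg (negbTE S1).
by rewrite /cayley; apply/idP/idP => /SV; rewrite invMg invgK.
Qed.

Definition circulant_conn (gT : finGroupType) (x : gT) (k l : nat) : {set gT} :=
  [set x ^+ k; x ^- k; x ^+ l; x ^- l].

Definition quartic_conn (gT : finGroupType) (x : gT) (k l : nat) : bool :=
  uniq [:: 1; x ^+ k; x ^- k; x ^+ l; x ^- l].

Lemma circulant_quartic_simple (gT : finGroupType) (x : gT) (k l : nat) :
  quartic_conn x k l -> simple_graph (cayley (circulant_conn x k l)).
Proof.
rewrite /quartic_conn => /andP[S1 _]; apply: cayley_simple.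
  by move: S1; rewrite !inE !negb_or -!andbA.
by move=> s; rewrite !inE -!orbA => /or4P[]/eqP->; rewrite ?invgK eqxx ?orbT.
Qed.

(* Main.v *)
Require Import Defs.
From mathcomp Require Import all_boot all_fingroup.
From mathcomp Require Import cyclic zify.

Import GroupScope.

(** Every vertex of a circulant quartic graph has degree 4, so counting the
    pairs (vertex, neighbour in [C]) in two ways shows that the numbers of
    neighbours in [C], summed over all vertices, give [4 * #|C|]
    ([sum_nb_in_circulant]).  For a (2,2)-regular set this reads
    [2 * n = 4 * #|C|], so [n] is even.

    If [k] and [l] are both odd and [n] is even, the graph is bipartite: the
    set [E] of odd powers of [x] meets every edge in exactly one end.
    Counting for [E] itself shows that [E] and its complement have the same
    size.  A vertex outside [E] has its two neighbours in [C] inside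
    [C :&: E], and a vertex of [E] has none there, so counting for [C :&: E]
    gives [2 * #|~: E| = 4 * #|C :&: E|]; hence [n = 2 * #|~: E|] is a
    multiple of 4.

    For the converses, call [C] antiperiodic under [g] when right
    multiplication by [g] exchanges [C] and its complement.  Such sets exist
    for [g = x ^+ d] as soon as [2 * d] divides [n]
    ([antiperiodic_set_exists]).  With [d = 1], the two [k]-neighbours of [v]
    are on the other side of [C] from [v], and its two [l]-neighbours, [l]
    being even, are on its side: two of the four are in [C].  With [d = 2] and
    [k], [l] odd, the two [k]-neighbours differ by an odd power of [x ^+ 2],
    so exactly one of them is in [C], and likewise for [l]. *)

Definition antiperiodic {gT : finGroupType} (g : gT) (C : {set gT}) : Prop :=
  forall y, (y * g \in C) = (y \notin C).

(** * Antiperiodic sets in a cyclic group *)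

Lemma antiperiodicX {gT : finGroupType} (g : gT) (C : {set gT}) (m : nat) (y : gT) :
  antiperiodic g C -> (y * g ^+ m \in C) = odd m (+) (y \in C).
Proof.
move=> gC; elim: m => [|m IHm]; first by rewrite expg0 mulg1.
by rewrite expgSr mulgA gC IHm /= addNb.
Qed.

(** The same rule for negative powers, as [y] and [y * g ^- m] play symmetric
    roles. *)
Lemma antiperiodicXV {gT : finGroupType} (g : gT) (C : {set gT}) (m : nat) (y : gT) :
  antiperiodic g C -> (y * g ^- m \in C) = odd m (+) (y \in C).
Proof.
move=> gC; rewrite -[in RHS](mulgKV (g ^+ m) y) (antiperiodicX g C m _ gC).
by rewrite addKb.
Qed.

Lemma antiperiodic_nontrivial {gT : finGroupType} (g : gT) (C : {set gT}) :
  antiperiodic g C -> C != set0 /\ C \proper [set: gT].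
Proof.
move=> gC; have := gC 1; case: (boolP (1 \in C)) => C1 Cg.
  split; first by apply/set0Pn; exists 1.
  by apply/properP; split; [exact: subsetT | exists (1 * g); rewrite ?inE ?Cg].
split; first by apply/set0Pn; exists (1 * g).
by apply/properP; split; [exact: subsetT | exists 1; rewrite ?inE].
Qed.

(** Cut the cyclic sequence of powers of [x] into blocks of length [d] and
    take every second block.  The number of blocks must be even for the
    alternation to close up, which is what makes the parity of [i %/ d] depend
    on [x ^+ i] only. *)
Lemma antiperiodic_set_exists {gT : finGroupType} (x : gT) (d : nat) :
  [set: gT] = <[x]> -> 0 < d -> 2 * d %| #[x] ->
  exists C : {set gT}, antiperiodic (x ^+ d) C.
Proof.
move=> genx d_gt0 /dvdnP[q def_n].
pose C := [set x ^+ nat_of_ord i | i : 'I_#[x] & odd (i %/ d)].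
have memC i : (x ^+ i \in C) = odd (i %/ d).
  have parity_mod : odd ((i %% #[x]) %/ d) = odd (i %/ d).
    rewrite [in RHS](divn_eq i #[x]) {3}def_n !mulnA divnMDl //.
    by rewrite oddD !oddM !andbF.
  apply/imsetP/idP => [[j] | odd_i].
    rewrite inE => odd_j /eqP; rewrite eq_expg_mod_order => /eqP eq_ij.
    by rewrite -parity_mod eq_ij modn_small.
  exists (Ordinal (ltn_pmod i (order_gt0 x))).
    by rewrite inE /= parity_mod.
  by rewrite /= expg_mod_order.
exists C => y; have /cycleP[i ->] : y \in <[x]> by rewrite -genx inE.
by rewrite -expgD !memC divnDr // divnn d_gt0 addn1.
Qed.

(** * Counting neighbours in a circulant quartic graph *)

(** As the four elements of the connection set are distinct, no neighbour is
    counted twice on the right. *)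
Lemma nb_in_circulant {gT : finGroupType} (x : gT) (k l : nat) (C : {set gT}) (v : gT) :
  quartic_conn x k l ->
  nb_in (cayley (circulant_conn x k l)) C v =
    (v * x ^+ k \in C) + (v * x ^- k \in C)
    + (v * x ^+ l \in C) + (v * x ^- l \in C).
Proof.
rewrite /quartic_conn cons_uniq => /andP[_ uniqS].
pose S := [:: x ^+ k; x ^- k; x ^+ l; x ^- l].
(* Left translation by [v] is a bijection from the suitable [s] in the
   connection set to the neighbours of [v] in [C]. *)
have -> : nb_in (cayley (circulant_conn x k l)) C v
          = #|[set s in S | v * s \in C]|.
  rewrite -(card_imset _ (mulgI v)); apply: eq_card => w.
  apply/idP/imsetP => [|[s]].
    rewrite !inE /cayley => /andP[Cw Sw]; exists (v^-1 * w); rewrite ?mulKVg //.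
    by move: Sw; rewrite !inE mulKVg Cw andbT -!orbA.
  rewrite !inE => /andP[Ss Cvs] ->.
  by rewrite /cayley mulKg Cvs !inE -!orbA.
rewrite -sum1dep_card big_mkcondr -big_uniq //= /S !big_cons big_nil.
by do 4!case: (_ \in C).
Qed.

Lemma card_translate {gT : finGroupType} (s : gT) (C : {set gT}) :
  \sum_v ((v * s)%g \in C : nat) = #|C|.
Proof.
rewrite (reindex_inj (mulIg s^-1)) -sum1_card [RHS]big_mkcond /=.
by apply: eq_bigr => v _; rewrite mulgKV; case: (v \in C).
Qed.

(** Each element of [C] is counted once for each of the four elements of the
    connection set. *)
Lemma sum_nb_in_circulant {gT : finGroupType} (x : gT) (k l : nat) (C : {set gT}) :
  quartic_conn x k l ->
  \sum_v nb_in (cayley (circulant_conn x k l)) C v = (4 * #|C|)%N.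
Proof.
move=> quartic; under eq_bigr do rewrite nb_in_circulant //.
by rewrite !big_split /= !card_translate !mulSn addn0 !addnA.
Qed.

Lemma regular_set_circulant {gT : finGroupType} (x g : gT) (k l : nat) (C : {set gT}) :
  antiperiodic g C ->
  (forall v, nb_in (cayley (circulant_conn x k l)) C v = 2) ->
  regular_set (cayley (circulant_conn x k l)) 2 2 C.
Proof.
by move=> /antiperiodic_nontrivial[C0 CT] nb2; split=> // v _; apply: nb2.
Qed.

Lemma nb_in_regular {T : finType} (e : rel T) (a : nat) (C : {set T}) (v : T) :
  regular_set e a a C -> nb_in e C v = a.
Proof. by case=> _ _ inC outC; case: (boolP (v \in C)); auto. Qed.

(** * Necessary divisibility conditions *)

Lemma regular_set_circulant_even {gT : finGroupType} (x : gT) (k l : nat) (C : {set gT}) :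
  quartic_conn x k l -> regular_set (cayley (circulant_conn x k l)) 2 2 C ->
  2 %| #|[set: gT]|.
Proof.
move=> quartic regC; have := sum_nb_in_circulant x k l C quartic.
under eq_bigr do rewrite (nb_in_regular _ _ _ _ regC).
by rewrite sum_nat_const -cardsT => eq_card; apply/dvdnP; exists #|C|; lia.
Qed.

(** Every edge joins [E] to its complement, so the vertices outside [E] already
    see all their neighbours in [C] inside [C :&: E]: the double count can be
    made on one side of the bipartition only, which gains a factor of 2 over
    [regular_set_circulant_even]. *)
Lemma regular_set_circulant_bipartite
    {gT : finGroupType} (x : gT) (k l : nat) (C E : {set gT}) :
  quartic_conn x k l -> odd k -> odd l -> antiperiodic x E ->
  regular_set (cayley (circulant_conn x k l)) 2 2 C ->
  4 %| #|[set: gT]|.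
Proof.
move=> quartic odd_k odd_l xE regC.
have flip m y : odd m -> (y * x ^+ m \in E) = (y \notin E).
  by move=> odd_m; rewrite (antiperiodicX x E m y xE) odd_m.
have flipV m y : odd m -> (y * x ^- m \in E) = (y \notin E).
  by move=> odd_m; rewrite (antiperiodicXV x E m y xE) odd_m.
have sum_outside c : \sum_v c * (v \notin E) = (c * #|~: E|)%N.
  rewrite -big_distrr -sum1_card [X in _ = (_ * X)%N]big_mkcond /=.
  by congr (_ * _)%N; apply: eq_bigr => v _; rewrite inE; case: (v \in E).
have sumE := sum_nb_in_circulant x k l E quartic.
have nbE v : nb_in (cayley (circulant_conn x k l)) E v = (4 * (v \notin E))%N.
  by rewrite nb_in_circulant // !flip // !flipV //; case: (v \in E).
have sumCE := sum_nb_in_circulant x k l (C :&: E) quartic.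
have nbCE v :
    nb_in (cayley (circulant_conn x k l)) (C :&: E) v = (2 * (v \notin E))%N.
  have := nb_in_regular _ _ _ v regC; rewrite !nb_in_circulant // !in_setI.
  by rewrite !flip // !flipV //; case: (v \in E); rewrite ?andbF ?andbT.
(* Both sides of the bipartition have the same size. *)
have {nbE} sumE' : (4 * #|~: E| = 4 * #|E|)%N.
  by rewrite -sumE -sum_outside; apply: eq_bigr.
have {nbCE} sumCE' : (2 * #|~: E| = 4 * #|C :&: E|)%N.
  by rewrite -sumCE -sum_outside; apply: eq_bigr.
have := cardsC E; rewrite -cardsT => cardE.
by apply/dvdnP; exists #|C :&: E|; lia.
Qed.

(** * The characterization *)

Theorem theorem3p2 (gT : finGroupType) (x : gT) (n k l : nat)
    (n_gt0 : 0 < n) (k_gt0 : 0 < k) (l_gt0 : 0 < l)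
    (gT_cyclic : [set: gT] = <[x]>) (gT_order : #|[set: gT]| = n)
    (quartic : quartic_conn x k l)
    (connected : connected_graph (cayley (circulant_conn x k l))) :
  (k = 1 %[mod 2] -> l = 0 %[mod 2] ->
     (exists C : {set gT}, regular_set (cayley (circulant_conn x k l)) 2 2 C)
     <-> 2 %| n)
  /\
  (k = 1 %[mod 2] -> l = 1 %[mod 2] ->
     (exists C : {set gT}, regular_set (cayley (circulant_conn x k l)) 2 2 C)
     <-> 4 %| n).
Proof.
have order_x : #[x] = n by rewrite orderE -gT_cyclic.
have even_n C :
    regular_set (cayley (circulant_conn x k l)) 2 2 C -> 2 %| n.
  by rewrite -gT_order; apply: regular_set_circulant_even.
have antiper1 : 2 %| n -> exists C : {set gT}, antiperiodic x C.
  rewrite -order_x => n_even.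
  exact: (antiperiodic_set_exists x 1 gT_cyclic isT n_even).
split=> k_mod l_mod.
  have odd_k : odd k by lia.
  have even_l : odd l = false by lia.
  split=> [[C /even_n //] | /antiper1[C xC]].
  exists C; apply: (regular_set_circulant _ _ _ _ _ xC) => v.
  rewrite nb_in_circulant // !(antiperiodicX _ _ _ _ xC).
  rewrite !(antiperiodicXV _ _ _ _ xC) odd_k even_l.
  by case: (v \in C).
have odd_k : odd k by lia.
have odd_l : odd l by lia.
split=> [[C regC] | n_div4].
  have [E xE] := antiper1 (even_n C regC).
  by rewrite -gT_order; apply: regular_set_circulant_bipartite xE regC.
rewrite -order_x in n_div4.
have [C x2C] := antiperiodic_set_exists x 2 gT_cyclic isT n_div4.
(* [v * x ^+ m] is [v * x ^- m] moved by [m] steps of [x ^+ 2]. *)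
have opposite m v : odd m -> (v * x ^+ m \in C) = (v * x ^- m \notin C).
  move=> odd_m; have -> : v * x ^+ m = v * x ^- m * (x ^+ 2) ^+ m.
    by rewrite -expgM mul2n -addnn expgD !mulgA mulgKV.
  by rewrite (antiperiodicX _ _ _ _ x2C) odd_m.
exists C; apply: (regular_set_circulant _ _ _ _ _ x2C) => v.
rewrite nb_in_circulant // !opposite //.
by case: (_ \in C); case: (_ \in C).
Qed.
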